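(* Let $V$ and $W$ be finite-dimensional real inner product spaces, let $A\colon V\to V$ be a symmetric positive definite linear operator, let $B\colon V\to W$ be a surjective linear operator, and let $\epsilon>0$. Let $S=BA^{-1}B^t$ and $S_\epsilon=B(A+\epsilon^{-1}B^tB)^{-1}B^t$, both operators $W\to W$. Then the operator norm of $I-\epsilon^{-1}S_\epsilon$ satisfies $$\|I-\epsilon^{-1}S_\epsilon\|=\frac{\epsilon}{\epsilon+\lambda_{\min}(S)}.$$
   Context: $B^t\colon W\to V$ is the adjoint of $B$; $I$ is the identity on $W$; the operator norm is the one induced by the inner product norm of $W$; $\lambda_{\min}$ denotes the minimum eigenvalue (so $W$ is understood to be nonzero). ''Symmetric positive definite'' means self-adjoint with $(Av,v)>0$ for all $v\ne 0$. The operator $I-\epsilon^{-1}S_\epsilon$ is the error propagation operator of the augmented Lagrangian method for the system $Au+B^tp=f$, $Bu=g$ (with $f\in V$, $g\in W$), namely the iteration $u^{m+1}=(A+\epsilon^{-1}B^tB)^{-1}(f+\epsilon^{-1}B^tg-B^tp^m)$, $p^{m+1}=p^m-\epsilon^{-1}(g-Bu^{m+1})$, $m\ge 0$. *)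

(* Defs.v *)
From HB Require Import structures.
From mathcomp Require Import all_boot all_order all_algebra.
From mathcomp Require Import classical_sets reals.

Set Implicit Arguments.
Unset Strict Implicit.
Unset Printing Implicit Defensive.

Import Order.TTheory GRing.Theory Num.Theory.
Local Open Scope classical_set_scope.
Local Open Scope ring_scope.

(* A finite-dimensional real inner product space is a [vectType R], with
   [R : realType], together with a positive definite symmetric bilinear form,
   which is passed around explicitly. *)
Notation inner_product V := {dot V for idfun}.

Definition is_adjoint (R : realType) (V W : vectType R)
    (dV : inner_product V) (dW : inner_product W)
    (B : 'Hom(V, W)) (Bt : 'Hom(W, V)) : Prop :=
  forall (v : V) (w : W), dW (B v) w = dV v (Bt w).

Definition is_spd (R : realType) (V : vectType R) (dV : inner_product V)
    (A : 'End(V)) : Prop :=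
  is_adjoint dV dV A A /\ forall v : V, v != 0 -> 0 < dV (A v) v.

(* [(f^-1)%VF] is the library's pseudo-inverse: it is the two-sided inverse
   when [f] is bijective, which holds for every SPD operator. *)
Definition schur (R : realType) (V W : vectType R)
    (A : 'End(V)) (B : 'Hom(V, W)) (Bt : 'Hom(W, V)) : 'End(W) :=
  (B \o A^-1 \o Bt)%VF.

Definition augmented (R : realType) (V W : vectType R) (eps : R)
    (A : 'End(V)) (B : 'Hom(V, W)) (Bt : 'Hom(W, V)) : 'End(V) :=
  A + eps^-1 *: (Bt \o B)%VF.

Definition schur_eps (R : realType) (V W : vectType R) (eps : R)
    (A : 'End(V)) (B : 'Hom(V, W)) (Bt : 'Hom(W, V)) : 'End(W) :=
  schur (augmented eps A B Bt) B Bt.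

Definition dnorm (R : realType) (V : vectType R) (dV : inner_product V)
    (v : V) : R :=
  Num.sqrt (dV v v).

(* [sup] returns 0 on unbounded sets; the set here is always bounded, as the
   space is finite-dimensional. *)
Definition opnorm (R : realType) (W : vectType R) (dW : inner_product W)
    (T : 'End(W)) : R :=
  sup [set dnorm dW (T w) | w in [set w : W | dnorm dW w <= 1]].

Definition is_min_eigenvalue (R : realType) (W : vectType R)
    (T : 'End(W)) (l : R) : Prop :=
  passmx.leigenvalue T l /\ forall m : R, passmx.leigenvalue T m -> l <= m.

(* Main.v *)
Require Import Defs.
From HB Require Import structures.
From mathcomp Require Import all_boot all_order all_algebra.
From mathcomp Require Import classical_sets reals.
From mathcomp Require Import ring lra.

Set Implicit Arguments.
Unset Strict Implicit.
Unset Printing Implicit Defensive.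

Import Order.TTheory GRing.Theory Num.Theory.
Local Open Scope ring_scope.

(** Write T for the error propagation operator I - eps^-1 S_eps.  Eliminating
    the augmented operator shows that u = T w solves u + eps^-1 S u = w
    ([error_propagation_resolvent]), so T is the inverse of I + eps^-1 S.
    Let m be the least eigenvalue of S and k = 1 + m / eps.  Since
    (S u, u) >= m (u, u), pairing the equation with u gives
    k (u, u) <= (w, u), hence k^2 (u, u) <= (w, w); an eigenvector of S for m
    is mapped by T to its multiple by k^-1.  So the norm of T is
    k^-1 = eps / (eps + m).

    It remains to find m, together with the Rayleigh bound m (v, v) <= (S v, v)
    ([selfadjoint_min_eigenvector]).  Take m to be the largest real number for
    which this bound holds for all v.  Then P = S - m I is positive
    semidefinite; were it injective, it would even satisfy
    (v, v) <= C (P v, v) for some C > 0 ([psd_coercive]), and m + C^-1 would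
    also satisfy the bound.  Coercivity comes from the Cauchy-Schwarz inequality
    for the semidefinite form (P x, y), taken at x = P^-1 v and y = v, once the
    form (P^-1 v, v) is known to be bounded ([form_bounded]).  This argument
    replaces the compactness of the unit sphere. *)

(** * Real inner products and positive semidefinite operators *)

Lemma ipC (R : realType) (V : vectType R) (d : inner_product V) (u v : V) :
  d u v = d v u.
Proof. by rewrite hermC expr0 mul1r. Qed.

Lemma ip_ge0 (R : realType) (V : vectType R) (d : inner_product V) (v : V) :
  0 <= d v v.
Proof.
have [->|/neq0_dnorm_gt0/ltW] := eqVneq v 0; last exact.
by rewrite linear0l.
Qed.

Lemma ip_eq0 (R : realType) (V : vectType R) (d : inner_product V) (v : V) :
  d v v = 0 -> v = 0.
Proof.
by move=> v0; apply/eqP/negP => /negP/(neq0_dnorm_gt0 (s := d)); rewrite v0 ltxx.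
Qed.

(** The form (P x, y) is nonnegative at s x - t y for all s and t.  As it may be
    degenerate, the choice of s and t depends on which of (P x, x) and (P y, y)
    is nonzero. *)
Lemma psd_cauchy_schwarz (R : realType) (V : vectType R)
    (d : inner_product V) (P : 'End(V)) (P_sym : is_adjoint d d P P)
    (P_psd : forall v, 0 <= d (P v) v) (x y : V) :
  d (P x) y ^+ 2 <= d (P x) x * d (P y) y.
Proof.
have Pyx : d (P y) x = d (P x) y by rewrite P_sym ipC.
have expand s t : 0 <= s ^+ 2 * d (P x) x - 2 * s * t * d (P x) y
                       + t ^+ 2 * d (P y) y.
  have := P_psd (s *: x - t *: y).
  have -> : P (s *: x - t *: y) = s *: P x - t *: P y.
    by rewrite linearB !linearZ.
  rewrite linearBl !linearBr /= !linearZl_LR !linearZr_LR /=.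
  by rewrite Pyx; congr (0 <= _); ring.
have := P_psd x; have := P_psd y; move: expand.
move: (d (P x) x) (d (P x) y) (d (P y) y) => a b c expand c_ge0 a_ge0.
have [c_gt0|] := ltP 0 c.
  have : 0 <= c * (a * c - b ^+ 2) by have := expand c b; congr (0 <= _); ring.
  by rewrite pmulr_rge0 // subr_ge0.
have [a_gt0 _|a_le0 c_le0] := ltP 0 a.
  have : 0 <= a * (a * c - b ^+ 2) by have := expand b a; congr (0 <= _); ring.
  by rewrite pmulr_rge0 // subr_ge0.
by have := expand 1 b; nra.
Qed.

(** * Boundedness and coercivity of quadratic forms *)

(** The frame operator of a basis, which turns the numbers (v, e) back into a
    vector; it lets the coordinates of v be bounded without an orthonormal
    basis. *)
Definition frame (R : realType) (V : vectType R) (d : inner_product V)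
    (v : V) : V :=
  \sum_(e <- vbasis {:V}) d v e *: e.

Lemma frame_is_linear (R : realType) (V : vectType R) (d : inner_product V) :
  linear (frame d).
Proof.
move=> a u v; rewrite /frame scaler_sumr -big_split /=; apply: eq_bigr => e _.
by rewrite linearPl scalerDl scalerA.
Qed.

HB.instance Definition _ (R : realType) (V : vectType R)
    (d : inner_product V) :=
  GRing.isLinear.Build R V V *:%R (frame d) (frame_is_linear d).

(** Pairing the frame operator at v with v gives the sum of the squares of the
    (v, e), so a vector of its kernel is orthogonal to a basis. *)
Lemma frame_ker0 (R : realType) (V : vectType R) (d : inner_product V) :
  lker (linfun (frame d)) == 0%VS.
Proof.
rewrite -subv0; apply/subvP => v; rewrite memv_ker lfunE /= memv0 => /eqP fv0.
have ve0 e : e \in vbasis {:V} -> d v e = 0.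
  move=> eV; apply/eqP; rewrite -sqrf_eq0.
  have /eqP: \sum_(e <- vbasis {:V}) d v e ^+ 2 = 0.
    transitivity (d (frame d v) v); last by rewrite fv0 linear0l.
    rewrite linear_sumlz; apply: eq_bigr => f _.
    by rewrite linearZl_LR /= (ipC d f) expr2.
  rewrite psumr_eq0 => [/allP/(_ e eV) //|f _]; exact: sqr_ge0.
apply/eqP/(ip_eq0 (d := d)); rewrite {2}(coord_vbasis (memvf v)) linear_sumr.
by apply: big1 => i _; rewrite linearZr_LR /= ve0 ?mulr0 // mem_nth ?size_tuple.
Qed.

(** Applying Q to v = G^-1 (G v), with G the frame operator, writes Q v as the
    sum of the vectors (v, e) h(e), where h(e) = Q (G^-1 e) does not depend on
    v; each product (v, e) (h(e), v) is then bounded by Cauchy-Schwarz. *)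
Lemma form_bounded (R : realType) (V : vectType R) (d : inner_product V)
    (Q : 'End(V)) :
  exists2 C : R, 0 < C & forall v : V, d (Q v) v <= C * d v v.
Proof.
pose G := linfun (frame d); pose h e := Q (G^-1%VF e).
pose c e := d e e + d (h e) (h e).
have c_ge0 : 0 <= \sum_(e <- vbasis {:V}) c e.
  by apply: sumr_ge0 => e _; rewrite addr_ge0 ?ip_ge0.
exists (1 + \sum_(e <- vbasis {:V}) c e); first by rewrite ltr_pwDl.
move=> v.
have -> : Q v = \sum_(e <- vbasis {:V}) d v e *: h e.
  rewrite -[in LHS](lker0_lfunK (frame_ker0 d) v) [linfun _ v]lfunE /= /frame.
  by rewrite !linear_sum /=; apply: eq_bigr => e _; rewrite !linearZ.
rewrite mulrDl mul1r linear_sumlz mulr_suml.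
apply: ler_wpDl; first exact: ip_ge0.
apply: ler_sum => e _; rewrite linearZl_LR /= /c mulrDl.
have idE w : (\1%VF : 'End(V)) w = w by rewrite lfunE.
have CS x y : d x y ^+ 2 <= d x x * d y y.
  have := @psd_cauchy_schwarz R V d \1%VF _ _ x y.
  rewrite !idE; apply=> [u w|w]; rewrite !idE //; exact: ip_ge0.
have := CS e v; have := CS (h e) v; rewrite (ipC d v e); nra.
Qed.

(** Cauchy-Schwarz for the form of P at P^-1 v and v reads
    (v, v)^2 <= (P^-1 v, v) (P v, v), and the first factor is at most
    C (v, v). *)
Lemma psd_coercive (R : realType) (V : vectType R) (d : inner_product V)
    (P : 'End(V)) (P_sym : is_adjoint d d P P)
    (P_psd : forall v, 0 <= d (P v) v) (P_inj : lker P == 0%VS) :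
  exists2 C : R, 0 < C & forall v : V, d v v <= C * d (P v) v.
Proof.
have [C C_gt0 bndC] := form_bounded d (P^-1)%VF.
exists C => // v; have [->|v0] := eqVneq v 0.
  by rewrite !linear0r mulr0.
have := psd_cauchy_schwarz P_sym P_psd ((P^-1)%VF v) v.
rewrite lker0_lfunVK // (ipC d v ((P^-1)%VF v)) => CS.
have vv_gt0 : 0 < d v v by exact: neq0_dnorm_gt0.
rewrite -(ler_pM2l vv_gt0) -expr2; apply: (le_trans CS).
by rewrite mulrCA mulrA ler_wpM2r.
Qed.

(** * The least eigenvalue and the operator norm *)

(** The constant m is the supremum of the lower bounds of the Rayleigh quotient;
    if S - m I were injective, it would be coercive and m could be increased. *)
Lemma selfadjoint_min_eigenvector (R : realType) (V : vectType R)
    (d : inner_product V) (S : 'End(V)) (S_sym : is_adjoint d d S S)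
    (V_neq0 : (0 < \dim {:V})%N) :
  exists m : R, (exists2 x : V, x != 0 & S x = m *: x) /\
    forall v : V, m * d v v <= d (S v) v.
Proof.
pose E : set R := fun m => forall v : V, m * d v v <= d (S v) v.
have [x x0] : exists x : V, x != 0.
  by exists (vpick {:V}); rewrite vpick0 -dimv_eq0 -lt0n.
have E_ub v : v != 0 -> ubound E (d (S v) v / d v v).
  move=> v0 m Em; rewrite ler_pdivlMr ?Em //; exact: neq0_dnorm_gt0.
have E_neq0 : nonempty E.
  have [C _ bndC] := form_bounded d (- S); exists (- C) => v.
  by rewrite mulNr lerNl -linearNl /=; have := bndC v; rewrite opp_lfunE.
have Esup : E (sup E).
  move=> v; have [->|v0] := eqVneq v 0; first by rewrite !linear0r mulr0.
  rewrite -ler_pdivlMr; last exact: neq0_dnorm_gt0.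
  exact: ge_sup E_neq0 (E_ub v v0).
exists (sup E); split=> //.
pose P := S - sup E *: \1%VF.
have PE v : P v = S v - sup E *: v.
  by rewrite add_lfunE opp_lfunE scale_lfunE lfunE.
have [P_inj|] := boolP (lker P == 0%VS); last first.
  rewrite -vpick0 => y0; exists (vpick (lker P)) => //.
  by have := memv_pick (lker P); rewrite memv_ker PE subr_eq0 => /eqP.
have P_sym : is_adjoint d d P P.
  by move=> u v; rewrite !PE linearBl linearBr /= linearZl_LR linearZr_LR /= S_sym.
have P_psd v : 0 <= d (P v) v
  by rewrite PE linearBl /= linearZl_LR subr_ge0 Esup.
have [C C_gt0 bndC] := psd_coercive P_sym P_psd P_inj.
suff /(ub_le_sup (ex_intro _ _ (E_ub x x0))) : E (sup E + C^-1).
  by rewrite gerDl leNgt invr_gt0 C_gt0.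
move=> v; have := bndC v; rewrite PE linearBl /= linearZl_LR /=.
by rewrite -ler_pdivrMl // lerBrDr addrC -mulrDl.
Qed.

(** The supremum is attained at the normalization of x. *)
Lemma opnorm_eigenvector (R : realType) (W : vectType R)
    (d : inner_product W) (T : 'End(W)) (c : R) (x : W) (c_ge0 : 0 <= c)
    (bnd : forall w : W, d (T w) (T w) <= c ^+ 2 * d w w)
    (x_neq0 : x != 0) (Tx : T x = c *: x) :
  opnorm d T = c.
Proof.
have xx_gt0 : 0 < d x x by exact: neq0_dnorm_gt0.
have normZ a (v : W) : 0 <= a -> dnorm d (a *: v) = a * dnorm d v.
  move=> a0; rewrite /dnorm linearZl_LR linearZr_LR /= mulrA -expr2.
  by rewrite sqrtrM ?sqr_ge0 // sqrtr_sqr ger0_norm.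
have nx_gt0 : 0 < dnorm d x by rewrite sqrtr_gt0.
pose y := (dnorm d x)^-1 *: x.
have ny : dnorm d y = 1 by rewrite normZ ?invr_ge0 ?ltW // mulVf // gt_eqF.
rewrite /opnorm; set E := (X in sup X).
have Ec : E c.
  exists y; first by rewrite /= ny.
  by rewrite /y linearZ /= Tx scalerA mulrC -scalerA normZ // ny mulr1.
have ubE : ubound E c.
  move=> _ [w /= nw <-]; apply: le_trans (_ : c * dnorm d w <= _).
    rewrite -normZ // /dnorm ler_wsqrtr // linearZl_LR linearZr_LR /= mulrA.
    by rewrite -expr2.
  by rewrite ler_piMr.
apply/eqP; rewrite eq_le; apply/andP; split; first by apply: ge_sup => //; exists c.
by apply: ub_le_sup => //; exists c.
Qed.

(** * Schur complements and the error propagation operator *)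

Lemma spd_ker0 (R : realType) (V : vectType R) (d : inner_product V)
    (A : 'End(V)) : is_spd d A -> lker A == 0%VS.
Proof.
move=> [_ A_pos]; rewrite -subv0; apply/subvP => v; rewrite memv_ker memv0.
by move=> /eqP Av0; apply/negP => /negP/A_pos; rewrite Av0 linear0l ltxx.
Qed.

Lemma augmented_spd (R : realType) (V W : vectType R)
    (dV : inner_product V) (dW : inner_product W) (eps : R)
    (A : 'End(V)) (B : 'Hom(V, W)) (Bt : 'Hom(W, V)) (A_spd : is_spd dV A)
    (B_adj : is_adjoint dV dW B Bt) (eps_gt0 : 0 < eps) :
  is_spd dV (augmented eps A B Bt).
Proof.
have [A_sym A_pos] := A_spd.
have augE v : augmented eps A B Bt v = A v + eps^-1 *: Bt (B v).
  by rewrite add_lfunE scale_lfunE comp_lfunE.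
split=> [u v|v v0]; rewrite !augE linearDl /= linearZl_LR /=.
  rewrite linearDr /= linearZr_LR /= A_sym.
  by rewrite -B_adj (ipC dV (Bt _)) -B_adj (ipC dW (B v)).
rewrite ltr_wpDr ?A_pos // ipC -B_adj.
by rewrite mulr_ge0 ?ip_ge0 // invr_ge0 ltW.
Qed.

Lemma schur_sym (R : realType) (V W : vectType R)
    (dV : inner_product V) (dW : inner_product W)
    (A : 'End(V)) (B : 'Hom(V, W)) (Bt : 'Hom(W, V)) (A_spd : is_spd dV A)
    (B_adj : is_adjoint dV dW B Bt) :
  is_adjoint dW dW (schur A B Bt) (schur A B Bt).
Proof.
move=> u v; have AK := lker0_lfunVK (spd_ker0 A_spd); have [A_sym _] := A_spd.
rewrite /schur !comp_lfunE /= B_adj -{1}(AK (Bt v)) -A_sym AK.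
by rewrite ipC -B_adj ipC.
Qed.

Lemma schur_psd (R : realType) (V W : vectType R)
    (dV : inner_product V) (dW : inner_product W)
    (A : 'End(V)) (B : 'Hom(V, W)) (Bt : 'Hom(W, V)) (A_spd : is_spd dV A)
    (B_adj : is_adjoint dV dW B Bt) (w : W) :
  0 <= dW (schur A B Bt w) w.
Proof.
have AK := lker0_lfunVK (spd_ker0 A_spd); have [_ A_pos] := A_spd.
rewrite /schur !comp_lfunE /= B_adj -{2}(AK (Bt w)) ipC.
have [->|/A_pos/ltW//] := eqVneq ((A^-1)%VF (Bt w)) 0.
by rewrite linear0r.
Qed.

(** With z = A_eps^-1 Bt w, where A_eps = A + eps^-1 Bt B, one has
    u = w - eps^-1 B z.  The equation A_eps z = Bt w says that A z = Bt u, so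
    S u = B z. *)
Lemma error_propagation_resolvent (R : realType) (V W : vectType R)
    (dV : inner_product V) (dW : inner_product W) (eps : R)
    (A : 'End(V)) (B : 'Hom(V, W)) (Bt : 'Hom(W, V)) (A_spd : is_spd dV A)
    (B_adj : is_adjoint dV dW B Bt) (eps_gt0 : 0 < eps) (w : W) :
  let u := (\1%VF - eps^-1 *: schur_eps eps A B Bt) w in
  u + eps^-1 *: schur A B Bt u = w.
Proof.
have aug_spd := augmented_spd A_spd B_adj eps_gt0.
pose z := ((augmented eps A B Bt)^-1)%VF (Bt w).
have zE : A z + eps^-1 *: Bt (B z) = Bt w.
  have := lker0_lfunVK (spd_ker0 aug_spd) (Bt w).
  by rewrite -/z add_lfunE scale_lfunE comp_lfunE.
have uE : (\1%VF - eps^-1 *: schur_eps eps A B Bt) w = w - eps^-1 *: B z.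
  by rewrite add_lfunE opp_lfunE scale_lfunE lfunE !comp_lfunE.
rewrite /= uE /schur !comp_lfunE /=.
have -> : Bt (w - eps^-1 *: B z) = A z.
  by apply/eqP; rewrite linearB linearZ /= -zE addrK.
by rewrite (lker0_lfunK (spd_ker0 A_spd)) subrK.
Qed.

Theorem mainTheorem5 (R : realType) (V W : vectType R)
    (dV : inner_product V) (dW : inner_product W)
    (A : 'End(V)) (B : 'Hom(V, W)) (Bt : 'Hom(W, V)) (eps : R)
    (W_neq0 : (0 < \dim {:W})%N)
    (A_spd : is_spd dV A)
    (B_surj : limg B = fullv)
    (B_adj : is_adjoint dV dW B Bt)
    (eps_gt0 : 0 < eps) :
  exists2 lmin : R, is_min_eigenvalue (schur A B Bt) lmin &
    opnorm dW (\1%VF - eps^-1 *: schur_eps eps A B Bt) = eps / (eps + lmin).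
Proof.
have S_psd := schur_psd A_spd B_adj.
have resolvent := error_propagation_resolvent A_spd B_adj eps_gt0.
have [m [[x x0 Sx] m_le]] :=
  selfadjoint_min_eigenvector (schur_sym A_spd B_adj) W_neq0.
move: resolvent Sx S_psd m_le; set T := (_ - _); set S := schur A B Bt.
move=> resolvent Sx S_psd m_le.
have mem_eig a y : (y \in passmx.leigenspace S a) = (S y == a *: y).
  by rewrite memv_ker add_lfunE opp_lfunE scale_lfunE id_lfunE subr_eq0.
have xx_gt0 : 0 < dW x x by exact: neq0_dnorm_gt0.
have m_ge0 : 0 <= m.
  by have := S_psd x; rewrite Sx linearZl_LR /= pmulr_lge0.
exists m.
  split=> [|a]; rewrite /passmx.leigenvalue.
    apply/eqP => eig0; have := mem_eig m x.
    by rewrite eig0 memv0 Sx eqxx (negPf x0).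
  rewrite -vpick0; set y := vpick _ => y0.
  have : y \in passmx.leigenspace S a by exact: memv_pick.
  rewrite mem_eig => /eqP Sy; have := m_le y.
  by rewrite Sy linearZl_LR /= ler_pM2r //; exact: neq0_dnorm_gt0.
have sum_gt0 : 0 < eps + m by rewrite ltr_wpDr.
pose k := (eps + m) / eps.
have k_gt0 : 0 < k by rewrite divr_gt0.
have kE : k = 1 + eps^-1 * m by rewrite /k mulrDl mulfV ?gt_eqF // mulrC.
rewrite -[eps / _]invrK invf_div -/k.
apply: (@opnorm_eigenvector _ _ _ _ _ x) => //; first by rewrite invr_ge0 ltW.
  move=> w; set u := T w.
  have wu : k * dW u u <= dW w u.
    rewrite -{1}(resolvent w) /= -/u linearDl /= linearZl_LR /= kE mulrDl mul1r.
    by rewrite lerD2l -mulrA ler_pM2l ?invr_gt0.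
  rewrite exprVn mulrC ler_pdivlMr ?exprn_gt0 //.
  (* Expanding |w - k u|^2 >= 0 gives
     (w, w) >= 2 k (w, u) - k^2 (u, u) >= k^2 (u, u). *)
  have := ip_ge0 dW (w - k *: u).
  rewrite linearBl !linearBr /= !linearZl_LR !linearZr_LR /= (ipC dW u w).
  by nra.
(* Both T x and k^-1 x solve u + eps^-1 S u = x; their difference y is killed by
   I + eps^-1 S, which is positive definite. *)
pose y := T x - k^-1 *: x.
have yE : y + eps^-1 *: S y = 0.
  have -> : S y = S (T x) - k^-1 *: (m *: x) by rewrite linearB linearZ /= Sx.
  rewrite /y scalerBr addrACA -opprD resolvent.
  rewrite !scalerA -scalerDl [X in X *: _](_ : _ = 1) ?scale1r ?subrr //.
  by rewrite -mulrA mulrCA -{1}[k^-1]mulr1 -mulrDr -kE mulVf ?gt_eqF.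
apply/eqP; rewrite -subr_eq0 -/y; apply/eqP/(ip_eq0 (d := dW)).
have : dW (y + eps^-1 *: S y) y = 0 by rewrite yE linear0l.
rewrite linearDl /= linearZl_LR /= => /eqP.
rewrite paddr_eq0 ?ip_ge0 // => [/andP[/eqP]//|].
by rewrite mulr_ge0 // invr_ge0 ltW.
Qed.
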